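(* $BR_6(K_{2,2},K_{4,4})=BR_7(K_{2,2},K_{4,4})=22$.
   Context: For bipartite graphs $H_1,H_2$ and a positive integer $m$, $BR_m(H_1,H_2)$ is the least positive integer $n$ such that for every subgraph $G$ of $K_{m,n}$ (parts of sizes $m$ and $n$), either $G$ contains a copy of $H_1$ or the bipartite complement $\overline{G}=K_{m,n}-E(G)$ contains a copy of $H_2$. *)

(* Defs.v *)
From mathcomp Require Import all_boot.

Set Implicit Arguments.
Unset Strict Implicit.
Unset Printing Implicit Defensive.

(* Irreflexivity of [adj] follows from [bg_bip]. *)
Record bigraph := BiGraph {
  vert : finType;
  adj : rel vert;
  bg_sym : symmetric adj;
  bg_bip : exists side : vert -> bool, forall x y, adj x y -> side x != side y
}.

Definition Kadj (m n : nat) : rel ('I_m + 'I_n) :=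
  fun x y => match x, y with
             | inl _, inr _ | inr _, inl _ => true
             | _, _ => false
             end.

Lemma Kadj_sym m n : symmetric (@Kadj m n).
Proof. by move=> [x|x] [y|y]. Qed.

Lemma Kadj_bip m n :
  exists side : 'I_m + 'I_n -> bool,
    forall x y, Kadj x y -> side x != side y.
Proof.
by exists (fun x => if x is inl _ then true else false) => -[x|x] [y|y].
Qed.

Definition K (m n : nat) : bigraph :=
  BiGraph (@Kadj_sym m n) (@Kadj_bip m n).

(* Copies are subgraphs, not necessarily induced, and may exchange the sides
   of the host graph. *)
Definition contains_copy (T : finType) (e : rel T) (H : bigraph) : Prop :=
  exists f : vert H -> T,
    injective f /\ forall x y, adj x y -> e (f x) (f y).

(* Subgraphs of K_{m,n} are taken on its full vertex set, i.e. they are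
   given by their edges. *)
Definition subgraphK (m n : nat) (G : rel ('I_m + 'I_n)) : Prop :=
  symmetric G /\ subrel G (@Kadj m n).

Definition bicompl (m n : nat) (G : rel ('I_m + 'I_n)) : rel ('I_m + 'I_n) :=
  fun x y => Kadj x y && ~~ G x y.

Definition arrows (m n : nat) (H1 H2 : bigraph) : Prop :=
  forall G : rel ('I_m + 'I_n), subgraphK G ->
    contains_copy G H1 \/ contains_copy (bicompl G) H2.

(* [is_BR m H1 H2 n] reads BR_m(H1, H2) = n; it is a relation because no such
   n need exist (e.g. when m is too small to accommodate H1 and H2). *)
Definition is_BR (m : nat) (H1 H2 : bigraph) (n : nat) : Prop :=
  [/\ 0 < n, arrows m n H1 H2
    & forall n', 0 < n' -> arrows m n' H1 H2 -> n <= n'].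

(* Main.v *)
Require Import Defs.
From mathcomp Require Import all_boot.

(** Upper bound: if the bipartite graph G between 6 rows and n columns has no
    K_{2,2}, and its bipartite complement no K_{4,4}, then counting 2-sets and
    4-sets of rows gives sum_j C(d_j,2) <= 15 and sum_j C(6-d_j,4) <= 3 * 15,
    where d_j is the degree of column j.  Since C(6-d,4) + 4 C(d,2) >= 5 for
    every d <= 6, this forces 5 n <= 45 + 4 * 15 = 105, that is n <= 21.
    Lower bound: the incidence graph between 7 points and the 21 pairs of
    points.  Two points lie in a single pair, and the pairs avoiding four given
    points are the 3 pairs among the other three points. *)

Set Implicit Arguments.
Unset Strict Implicit.
Unset Printing Implicit Defensive.

(** Restrict a colouring of the larger host to a corner: a copy found there is also a copy in the
    whole. This carries the upper bound from 6 rows to 7, and the counterexample on 7 rows to fewer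
    rows and columns. *)
Lemma arrows_widen m n m' n' H1 H2 :
  m <= m' -> n <= n' -> arrows m n H1 H2 -> arrows m' n' H1 H2.
Proof.
move=> le_m le_n arr G [symG subG].
pose phi (x : 'I_m + 'I_n) : 'I_m' + 'I_n' :=
  match x with
  | inl i => inl (widen_ord le_m i)
  | inr j => inr (widen_ord le_n j)
  end.
have phi_inj : injective phi.
  by move=> [x|x] [y|y] //= [/val_inj ->].
have phiK x y : Kadj (phi x) (phi y) = Kadj x y by case: x y => [x|x] [y|y].
have [|[f [f_inj fG]]|[f [f_inj fG]]] := arr (fun x y => G (phi x) (phi y)).
- split=> [x y|x y /subG]; [exact: symG | by rewrite phiK].
- by left; exists (phi \o f); split=> [|x y /fG]; first exact: inj_comp.
- right; exists (phi \o f); split=> [|x y /fG]; first exact: inj_comp.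
  by rewrite /bicompl /= phiK.
Qed.

Definition nbhd m n (G : rel ('I_m + 'I_n)) (j : 'I_n) : {set 'I_m} :=
  [set i | G (inl i) (inr j)].

Lemma bicompl_sub m n (G : rel ('I_m + 'I_n)) :
  subgraphK G -> subgraphK (bicompl G).
Proof.
case=> symG _; split=> [x y|x y /andP[] //].
by rewrite /bicompl symG Kadj_sym.
Qed.

Lemma nbhd_bicompl m n (G : rel ('I_m + 'I_n)) j :
  nbhd (bicompl G) j = ~: nbhd G j.
Proof. by apply/setP=> i; rewrite !inE. Qed.

Lemma copy_of_sets m n a b (G : rel ('I_m + 'I_n))
    (A : {set 'I_m}) (B : {set 'I_n}) :
    subgraphK G -> a <= #|A| -> b <= #|B| ->
    {in A & B, forall i j, G (inl i) (inr j)} ->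
  contains_copy G (K a b).
Proof.
move=> [symG _] leA leB GAB.
pose f (x : 'I_a + 'I_b) : 'I_m + 'I_n :=
  match x with
  | inl i => inl (enum_val (widen_ord leA i))
  | inr j => inr (enum_val (widen_ord leB j))
  end.
exists f; split=> [[x|x] [y|y] //= [] /enum_val_inj [] /val_inj -> //|].
by move=> [x|x] [y|y] //= _; [|rewrite symG]; apply: GAB; apply: enum_valP.
Qed.

(** A copy may exchange the sides of the host, but as both parts of [K a.+1 a.+1] have the same
    size, renaming them undoes the exchange. *)
Lemma square_copy_inj m n a (G : rel ('I_m + 'I_n)) :
    subgraphK G -> contains_copy G (K a.+1 a.+1) ->
  exists (g : 'I_a.+1 -> 'I_m) (h : 'I_a.+1 -> 'I_n),
    [/\ injective g, injective h & forall i j, g i \in nbhd G (h j)].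
Proof.
move=> [symG subG] [f [f_inj fG]].
have fGlr i j : G (f (inl i)) (f (inr j)) by exact: fG.
have fGrl i j : G (f (inr i)) (f (inl j)) by exact: fG.
(* [k1] is the part whose vertex [ord0] lands on a row; edges then force all of [k2] onto columns
   and all of [k1] onto rows. Later [x0] and [y0] also serve as default values. *)
have [k1 [k2 [k1_inj k2_inj [x0 ek1] Gk]]] :
    exists k1 k2 : 'I_a.+1 -> 'I_a.+1 + 'I_a.+1,
      [/\ injective k1, injective k2, exists x0, f (k1 ord0) = inl x0
        & forall i j, G (f (k1 i)) (f (k2 j))].
  case e0: (f (inl ord0)) => [x0|y0].
    exists inl, inr; split=> [? ? []|? ? []||] //; by exists x0.
  exists inr, inl; split=> [? ? []|? ? []||] //.
  case e1: (f (inr ord0)) => [x0|y1]; first by exists x0.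
  by have := subG _ _ (fGlr ord0 ord0); rewrite e0 e1.
have right j : exists y, f (k2 j) = inr y.
  have := subG _ _ (Gk ord0 j); rewrite ek1.
  by case: (f (k2 j)) => // y _; exists y.
have [y0 ek2] := right ord0.
have left i : exists x, f (k1 i) = inl x.
  have := subG _ _ (Gk i ord0); rewrite ek2.
  by case: (f (k1 i)) => // x _; exists x.
pose g i := if f (k1 i) is inl x then x else x0.
pose h j := if f (k2 j) is inr y then y else y0.
have gE i : f (k1 i) = inl (g i) by rewrite /g; have [x ->] := left i.
have hE j : f (k2 j) = inr (h j) by rewrite /h; have [y ->] := right j.
exists g, h; split=> [i i' eg|j j' eh|i j].
- by apply/k1_inj/f_inj; rewrite !gE eg.
- by apply/k2_inj/f_inj; rewrite !hE eh.
- by rewrite inE -gE -hE.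
Qed.

(** Double counting of pairs of an [a]-set of rows and a column adjacent to all of it: an [a]-set
    with more than [b] such columns spans a copy. *)
Lemma copy_or_count m n a b (G : rel ('I_m + 'I_n)) :
    subgraphK G ->
  contains_copy G (K a b.+1) \/ \sum_j 'C(#|nbhd G j|, a) <= 'C(m, a) * b.
Proof.
move=> subG; pose cols (A : {set 'I_m}) := [set j | A \subset nbhd G j].
have [/exists_inP[A /eqP cardA big]|/exists_inPn small] :=
  boolP [exists (A : {set 'I_m} | #|A| == a), b < #|cols A|].
  left; apply: (@copy_of_sets _ _ _ _ _ A (cols A)); rewrite ?cardA //.
  by move=> i j Ai; rewrite inE => /subsetP/(_ i Ai); rewrite inE.
right; have -> : \sum_j 'C(#|nbhd G j|, a) =
    \sum_(A : {set 'I_m} | #|A| == a) #|cols A|.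
  under [RHS]eq_bigr do rewrite -sum1_card.
  rewrite (exchange_big_dep xpredT) //=; apply: eq_bigr => j _.
  rewrite -cards_draws -sum1_card; apply: eq_bigl => A.
  by rewrite !inE andbC.
have -> : 'C(m, a) = #|[set A : {set 'I_m} | #|A| == a]|.
  by rewrite card_draws card_ord.
rewrite -sum_nat_const; under [leqRHS]eq_bigl => A do rewrite inE.
by apply: leq_sum => A /small; rewrite -leqNgt.
Qed.

Lemma arrows_6_22 : arrows 6 22 (K 2 2) (K 4 4).
Proof.
move=> G subG.
have [|le2] := copy_or_count 2 1 subG; first by left.
have [|le4] := copy_or_count 4 3 (bicompl_sub subG); first by right.
(* The factor 4 balances degrees 1 and 2, where equality holds. *)
have weight j : 5 <= 'C(#|nbhd (bicompl G) j|, 4) + 4 * 'C(#|nbhd G j|, 2).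
  rewrite nbhd_bicompl cardsCs setCK card_ord.
  have : #|nbhd G j| <= 6 by rewrite -[leqRHS]card_ord max_card.
  by move: #|_|; do 7?case.
(* Summing over the 22 columns would give 110 <= 105. *)
have := leq_add le4 (leq_mul (leqnn 4) le2).
rewrite big_distrr -big_split => /(leq_trans (leq_sum _ (fun j _ => weight j))).
by rewrite sum_nat_const card_ord.
Qed.

Lemma not_arrows_7_21 : ~ arrows 7 21 (K 2 2) (K 4 4).
Proof.
pose pairs := [set A : {set 'I_7} | #|A| == 2].
have card_pairs : 21 = #|pairs| by rewrite card_draws card_ord.
pose pair (j : 'I_21) : {set 'I_7} := enum_val (cast_ord card_pairs j).
have pair_inj : injective pair by move=> j j' /enum_val_inj/cast_ord_inj.
have card_pair j : #|pair j| = 2.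
  by have := enum_valP (cast_ord card_pairs j); rewrite inE => /eqP.
pose G (x y : 'I_7 + 'I_21) := match x, y with
  | inl i, inr j | inr j, inl i => i \in pair j
  | _, _ => false
  end.
have subG : subgraphK G by split=> [[x|x] [y|y]|[x|x] [y|y]].
have nbhdG j : nbhd G j = pair j by apply/setP=> i; rewrite inE.
move=> /(_ G subG) [/(square_copy_inj subG)|
                    /(square_copy_inj (bicompl_sub subG))].
- case=> g [h [g_inj h_inj gh]].
  (* Both columns would be the one pair formed by the two chosen points. *)
  have hE j : pair (h j) = g @: setT.
    apply/esym/eqP; rewrite eqEcard card_imset // cardsT card_ord card_pair.
    by rewrite andbT; apply/subsetP=> _ /imsetP[i _ ->]; rewrite -nbhdG.
  by have /pair_inj/h_inj := etrans (hE ord0) (esym (hE ord_max)).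
- case=> g [h [g_inj h_inj gh]].
  (* Four distinct pairs would have to fit among the three remaining points. *)
  have : #|(pair \o h) @: setT| <= 'C(#|~: (g @: setT)|, 2).
    rewrite -cards_draws; apply/subset_leq_card/subsetP=> _ /imsetP[j _ ->].
    rewrite inE /= card_pair eqxx andbT -nbhdG -setCS setCK -nbhd_bicompl.
    by apply/subsetP=> _ /imsetP[i _ ->].
  rewrite card_imset; last exact: inj_comp.
  by rewrite cardsT [#|~: _|]cardsCs setCK card_imset // cardsT !card_ord.
Qed.

Theorem theorem4 : is_BR 6 (K 2 2) (K 4 4) 22 /\ is_BR 7 (K 2 2) (K 4 4) 22.
Proof.
have lower m n : m <= 7 -> arrows m n (K 2 2) (K 4 4) -> 22 <= n.
  move=> le_m arr; rewrite leqNgt; apply/negP=> lt_n.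
  exact/not_arrows_7_21/(arrows_widen le_m _ arr).
split; split=> // [|n' _]; try exact: lower.
- exact: arrows_6_22.
- exact: arrows_widen arrows_6_22.
Qed.
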